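(* Let $H$ be a real Hilbert space with $\dim H\ge 2$. Then for every $0<\lambda<1$, $$J_\lambda^\perp(H)=\sqrt{\lambda^2+(1-\lambda)^2}.$$
   Context: For a real Banach space $X$, $S_X=\{x\in X:\|x\|=1\}$. For $x,y\in X$, $x\perp_B y$ (Birkhoff--James orthogonality) means $\|x\|\le\|x+ty\|$ for every $t\in\mathbb R$. For $\lambda\in[0,1]$, $$J_\lambda^\perp(X)=\sup\{\min\{\|\lambda x+(1-\lambda)y\|,\|\lambda x-(1-\lambda)y\|\}: x,y\in S_X,\ x\perp_B y\}.$$ *)

(* Defs.v *)
From HB Require Import structures.
From mathcomp Require Import all_boot all_order all_algebra.
From mathcomp Require Import all_classical all_reals all_analysis.

Set Implicit Arguments.
Unset Strict Implicit.
Unset Printing Implicit Defensive.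

Import Order.TTheory GRing.Theory Num.Theory.
Import numFieldNormedType.Exports.

Local Open Scope classical_set_scope.
Local Open Scope ring_scope.

Section Banach.
Context {R : realType}.
Implicit Type X : completeNormedModType R.

Definition unit_sphere X : set X := [set x | `|x| = 1].

Definition bj_orthogonal X (x y : X) : Prop :=
  forall t : R, `|x| <= `|x + t *: y|.

(* [sup] is the real-valued supremum (0 by convention on the empty set); for
   0 <= lambda <= 1 the set below is bounded above by 1. *)
Definition J_perp X (lambda : R) : R :=
  sup [set m | exists x y : X,
    [/\ unit_sphere x, unit_sphere y, bj_orthogonal x y &
        m = Num.min `|lambda *: x + (1 - lambda) *: y|
                    `|lambda *: x - (1 - lambda) *: y|]].

(* [vectType] only covers finite-dimensional spaces, hence this formulation of
   "dim V >= n" by the existence of n linearly independent vectors. *)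
Definition dim_ge (n : nat) (V : lmodType R) : Prop :=
  exists u : 'I_n -> V, forall a : 'I_n -> R,
    \sum_(i < n) a i *: u i = 0 -> forall i, a i = 0.

(* [{dot X for idfun}] is the type of symmetric positive definite bilinear
   forms; a real Hilbert space is a Banach space whose norm is induced by one
   of them. *)
Definition induces_norm X (dot : {dot X for idfun}) : Prop :=
  forall x : X, `|x| = Num.sqrt (dot x x).

End Banach.

Arguments J_perp {R} X lambda.

(* Main.v *)
Require Import Defs.
From HB Require Import structures.
From mathcomp Require Import all_boot all_order all_algebra.
From mathcomp Require Import all_classical all_reals all_analysis.
From mathcomp Require Import ring lra.

Import Order.TTheory GRing.Theory Num.Theory.
Import numFieldNormedType.Exports.

Local Open Scope ring_scope.

(** In an inner product space Birkhoff-James orthogonality is ordinary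
orthogonality, so for unit vectors [x] and [y] with [bj_orthogonal x y] the
theorem of Pythagoras gives
[`|a *: x + b *: y| = Num.sqrt (a ^+ 2 + b ^+ 2)] for all scalars, whatever
their signs ([norm_orthonormal]). The two norms under the minimum that defines
[J_perp] are therefore both equal to the announced value, which depends on
neither [x] nor [y]: the supremum is taken over a set with at most one element.
The hypothesis on the dimension serves to show that this set is not empty, by
one step of the Gram-Schmidt process ([exists_orthonormal_pair]). *)

Section InnerProduct.
Context {R : realType} {H : completeNormedModType R}.
Context {dot : {dot H for idfun}} (Hdot : induces_norm dot).
Implicit Types (x y u v : H) (a b t : R).

Lemma dotC x y : dot x y = dot y x.
Proof. by rewrite hermC expr0 mul1r. Qed.

Lemma dotZl a x y : dot (a *: x) y = a * dot x y.
Proof. by rewrite linearZl_LR. Qed.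

Lemma dotZr a x y : dot x (a *: y) = a * dot x y.
Proof. by rewrite linearZr_LR. Qed.

Lemma normsq_dot x : `|x| ^+ 2 = dot x x.
Proof.
rewrite Hdot sqr_sqrtr //.
have [->|x0] := eqVneq x 0; first by rewrite linear0l.
exact/ltW/neq0_dnorm_gt0.
Qed.

Lemma normsq_comb a b x y :
  `|a *: x + b *: y| ^+ 2 =
  a ^+ 2 * `|x| ^+ 2 + a * b * dot x y *+ 2 + b ^+ 2 * `|y| ^+ 2.
Proof.
rewrite !normsq_dot linearDl !linearDr.
rewrite /= !dotZl !dotZr (dotC y x); ring.
Qed.

(** The vector [x - dot x y *: y] is the orthogonal projection of [x] on the
complement of the unit vector [y]; its squared norm is that of [x] diminished
by [dot x y ^+ 2], so it is shorter than [x] as soon as [dot x y] is nonzero. *)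
Lemma bj_orthogonal_dot0 x y : `|y| = 1 -> bj_orthogonal x y -> dot x y = 0.
Proof.
move=> y1 /(_ (- dot x y)).
rewrite -(@ler_pXn2r _ 2) ?nnegrE ?normr_ge0 // -[X in X + _]scale1r.
rewrite normsq_comb y1 => le_sq.
have /eqP : dot x y ^+ 2 = 0 by apply/eqP; rewrite eq_le sqr_ge0 andbT; lra.
by rewrite sqrf_eq0 => /eqP.
Qed.

Lemma dot0_bj_orthogonal x y : dot x y = 0 -> bj_orthogonal x y.
Proof.
move=> xy0 t.
rewrite -(@ler_pXn2r _ 2) ?nnegrE ?normr_ge0 // -[X in `|X + _|]scale1r.
rewrite normsq_comb xy0 mulr0 mul0rn addr0 expr1n mul1r lerDl.
by rewrite mulr_ge0 ?sqr_ge0.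
Qed.

Lemma norm_orthonormal a b x y : `|x| = 1 -> `|y| = 1 -> dot x y = 0 ->
  `|a *: x + b *: y| = Num.sqrt (a ^+ 2 + b ^+ 2).
Proof.
move=> x1 y1 xy0; rewrite -[LHS]ger0_norm // -sqrtr_sqr normsq_comb.
by rewrite x1 y1 xy0 mulr0 mul0rn addr0 expr1n !mulr1.
Qed.

Lemma norm_normalize x : x != 0 -> `| `|x|^-1 *: x| = 1.
Proof. by move=> x0; rewrite normrZ normfV normr_id mulVf // normr_eq0. Qed.

Lemma dim_ge2_indep : dim_ge 2 H ->
  exists u v, forall a b, a *: u + b *: v = 0 -> a = 0 /\ b = 0.
Proof.
case=> w free_w; exists (w ord0), (w ord_max) => a b ab0.
pose c (i : 'I_2) := if i == ord0 then a else b.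
have c0 : forall i, c i = 0.
  apply: free_w; rewrite big_ord_recl big_ord1 -[RHS]ab0 /c /=.
  by congr (_ + _ *: w _); apply: val_inj.
by split; [rewrite -(c0 ord0) | rewrite -(c0 ord_max)].
Qed.

Lemma exists_orthonormal_pair : dim_ge 2 H ->
  exists x y, [/\ `|x| = 1, `|y| = 1 & dot x y = 0].
Proof.
move=> /dim_ge2_indep[u [v free_uv]].
have u0 : u != 0.
  apply/eqP => u0; have [|/eqP] := free_uv 1 0; last by rewrite oner_eq0.
  by rewrite u0 scaler0 scale0r addr0.
pose x := `|u|^-1 *: u; have x1 : `|x| = 1 by exact: norm_normalize.
pose z := v - dot x v *: x.
have z0 : z != 0.
  apply/eqP => z0; have [] := free_uv (- dot x v * `|u|^-1) 1.
    by rewrite -scalerA scaleNr scale1r addrC.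
  by move=> _ /eqP; rewrite oner_eq0.
exists x, (`|z|^-1 *: z); split; rewrite ?norm_normalize //.
rewrite dotZr linearBr /= dotZr -normsq_dot x1 expr1n mulr1.
by rewrite subrr mulr0.
Qed.

End InnerProduct.

Theorem proposition2p12 (R : realType) (H : completeNormedModType R)
    (dot : {dot H for idfun}) (Hdot : induces_norm dot) (Hdim : dim_ge 2 H)
    (lambda : R) (lambda_gt0 : 0 < lambda) (lambda_lt1 : lambda < 1) :
  J_perp H lambda = Num.sqrt (lambda ^+ 2 + (1 - lambda) ^+ 2).
Proof.
have min_norm (x y : H) : `|x| = 1 -> `|y| = 1 -> dot x y = 0 ->
    Num.min `|lambda *: x + (1 - lambda) *: y|
            `|lambda *: x - (1 - lambda) *: y| =
    Num.sqrt (lambda ^+ 2 + (1 - lambda) ^+ 2).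
  move=> x1 y1 xy0; rewrite -scaleNr !(norm_orthonormal Hdot) // sqrrN.
  exact: minxx.
rewrite /J_perp -[RHS]sup1; congr (sup _); apply/seteqP; split => m /=.
  move=> [x [y [x1 y1 /(bj_orthogonal_dot0 Hdot _ _ y1) xy0 ->]]].
  exact: min_norm.
move=> ->; have [x [y [x1 y1 xy0]]] := exists_orthonormal_pair Hdot Hdim.
exists x, y; split => //; first exact: (dot0_bj_orthogonal Hdot).
by rewrite min_norm.
Qed.
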